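(* Let $a$ be a strongly regular scale factor and fix $\tau>0$. For $0<\rho<\rho_{\mathcal M_\tau}$ let $t_0=t_0(\tau,\rho)\in(0,\tau)$ be defined by $\rho=\int_{t_0}^{\tau}\frac{a(t)}{\sqrt{a^2(\tau)-a^2(t)}}dt$, and let \[ g_{\tau\tau}(\tau,\rho)=-\left[1-\dot a(\tau)\int_{t_0}^{\tau}\frac{\ddot a(t)}{\dot a(t)^2}\left(\frac{\sqrt{a^2(\tau)-a^2(t_0)}}{\sqrt{a^2(\tau)-a^2(t)}}-1\right)dt\right]^2 . \] Then \[ \lim_{\rho\to\rho_{\mathcal M_\tau}^-}g_{\tau\tau}(\tau,\rho)=-\left[1-\dot a(\tau)\int_{0}^{\tau}\frac{\ddot a(t)}{\dot a(t)^2}\left(\frac{a(\tau)}{\sqrt{a^2(\tau)-a^2(t)}}-1\right)dt\right]^2, \] and the value $g_{\tau\tau}(\tau,\rho_{\mathcal M_\tau})$ defined by this limit satisfies $\infty>-g_{\tau\tau}(\tau,\rho_{\mathcal M_\tau})>0$.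
   Context: A function $a:[0,\infty)\to[0,\infty)$ is a regular scale factor if: (a) $a(0)=0$; (b) $a$ is increasing and continuous on $[0,\infty)$ and twice continuously differentiable on $(0,\infty)$, with an inverse function on $[0,\infty)$; (c) for all $t>0$, $\frac{a(t)\ddot a(t)}{\dot a(t)^2}\le 1$ (the quotient presupposes $\dot a(t)\neq0$ for $t>0$). It is strongly regular if, in addition, there is a constant $K\ge 1$ with $\frac{a(t)\ddot a(t)}{\dot a(t)^2}\ge -K$ for all $t>0$. For $\tau>0$, $\rho_{\mathcal M_\tau}=\int_0^\tau \frac{a(t)}{\sqrt{a^2(\tau)-a^2(t)}}dt$ (the Fermi radius at proper time $\tau$). The function $g_{\tau\tau}$ is the $d\tau^2$ coefficient of the Robertson–Walker metric $-dt^2+a^2(t)[d\chi^2+\dots]$ written in Fermi coordinates $(\tau,\rho,\dots)$ of the comoving observer at $\chi=0$; $\rho\to\rho_{\mathcal M_\tau}^-$ corresponds to $t_0\to0^+$. *)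

(* Defs.v *)
From HB Require Import structures.
From mathcomp Require Import all_boot all_order all_algebra.
From mathcomp Require Import all_classical all_reals all_analysis.
Set Implicit Arguments. Unset Strict Implicit. Unset Printing Implicit Defensive.
Import Order.TTheory GRing.Theory Num.Theory.
Import numFieldNormedType.Exports.
Local Open Scope classical_set_scope.
Local Open Scope ring_scope.

Section ScaleFactor.
Variable R : realType.
Implicit Types (a : R -> R) (tau s t : R).

Definition adot a : R -> R := derive1 a.
Definition addot a : R -> R := derive1 (derive1 a).

Definition accel_ratio a t : R := a t * addot a t / (adot a t) ^+ 2.

Definition regular_scale_factor a : Prop :=
  a 0 = 0 /\
      (forall t, 0 <= t -> 0 <= a t) /\
      {in `[0, +oo[ &, forall x y, x < y -> a x < a y} /\
      (forall y, 0 <= y -> exists2 t, 0 <= t & a t = y) /\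
      {within `[0, +oo[, continuous a} /\
      (forall t, 0 < t -> derivable a t 1 /\ derivable (adot a) t 1) /\
      {in `]0, +oo[, continuous (addot a)} /\
      (forall t, 0 < t -> adot a t != 0 /\ accel_ratio a t <= 1).

Definition strongly_regular_scale_factor a : Prop :=
  regular_scale_factor a /\
  exists2 K : R, 1 <= K & forall t, 0 < t -> - K <= accel_ratio a t.

Definition fermi_integrand a tau t : R :=
  a t / Num.sqrt (a tau ^+ 2 - a t ^+ 2).

Definition rho_of_t0 a tau (t0 : R) : R :=
  \int[lebesgue_measure]_(t in `]t0, tau[) fermi_integrand a tau t.

Definition fermi_radius a tau : R := rho_of_t0 a tau 0.

Definition gtt_integrand a tau (t0 : R) t : R :=
  addot a t / (adot a t) ^+ 2 *
  (Num.sqrt (a tau ^+ 2 - a t0 ^+ 2) / Num.sqrt (a tau ^+ 2 - a t ^+ 2) - 1).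

Definition g_tautau a tau (t0 : R) : R :=
  - (1 - adot a tau *
         \int[lebesgue_measure]_(t in `]t0, tau[) gtt_integrand a tau t0 t) ^+ 2.

Definition gtt_limit_integrand a tau t : R :=
  addot a t / (adot a t) ^+ 2 *
  (a tau / Num.sqrt (a tau ^+ 2 - a t ^+ 2) - 1).

Definition g_tautau_limit a tau : R :=
  - (1 - adot a tau *
         \int[lebesgue_measure]_(t in `]0, tau[) gtt_limit_integrand a tau t) ^+ 2.

End ScaleFactor.

(* Main.v *)
(* Write [s t = sqrt (a tau ^ 2 - a t ^ 2)] and [H = adot / a].  The condition
   [a addot <= adot ^ 2] says that [H] is nonincreasing, and strong regularity
   gives [|addot / adot ^ 2| <= K / a].

   Limit: the truncated integrand, extended by [0] below [t0], and the limiting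
   integrand differ by at most [K (a t0 / a tau) / s].  As [1 / s] is integrable
   on ]0, tau[, the integrals differ by [O(a t0)], and [t0 -> 0] as [rho] tends
   to the Fermi radius because [rho] decreases strictly with [t0].

   Positivity: from [addot / adot ^ 2 <= 1 / a] and [adot tau <= a tau * H t] the
   integrand, multiplied by [adot tau], is at most
   [a tau * adot / a ^ 2 * (a tau / s - 1)], the derivative of [(a tau - s) / a],
   which increases from [0] to [1].  The inequality is strict near [0], where
   [H > H tau]. *)
Require Import Defs.
From HB Require Import structures.
From mathcomp Require Import all_boot all_order all_algebra.
From mathcomp Require Import all_classical all_reals all_analysis.
From mathcomp Require Import measurable_realfun ring lra.
Import Order.TTheory GRing.Theory Num.Theory.
Import numFieldNormedType.Exports.
Local Open Scope classical_set_scope.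
Local Open Scope ring_scope.

(** * Integrability of nonnegative derivatives on an open interval *)

Section PrimitiveOnOpenInterval.
Context {R : realType}.
Notation mu := (@lebesgue_measure R).
Implicit Types (f F : R -> R) (a b M : R).

Lemma continuous_oo_measurable f a b :
  {in `]a, b[, continuous f} -> measurable_fun `]a, b[ f.
Proof.
move=> cf; apply: open_continuous_measurable_fun.
- exact: interval_open.
- by move=> x; rewrite inE => xab; exact: cf.
Qed.

(** Nothing is known of [F] at the end points, so the fundamental theorem is applied on closed
    intervals exhausting []a, b[] and monotone convergence passes to the union. *)
Lemma ge0_integral_oo_le F f a b M : 0 <= M ->
  (forall x : R, x \in `]a, b[ -> is_derive x 1 F (f x)) ->
  {in `]a, b[, continuous f} -> {in `]a, b[, forall x, 0 <= f x} ->
  (forall x y, a < x -> x < y -> y < b -> F y - F x <= M) ->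
  (\int[mu]_(x in `]a, b[) (f x)%:E <= M%:E)%E.
Proof.
move=> M0 dF cf f0 FM.
pose I (n : nat) : set R := `[a + n.+1%:R^-1, b - n.+1%:R^-1]%classic.
have Iab n x : I n x -> x \in `]a, b[.
  have n0 : 0 < n.+1%:R^-1 :> R by rewrite invr_gt0.
  rewrite /I /= !in_itv /= => /andP[ax xb].
  by rewrite (lt_le_trans _ ax) ?ltrDl// (le_lt_trans xb)// gtrBl.
have UI : (\bigcup_n I n = `]a, b[)%classic.
  apply/seteqP; split=> [x [n _ /Iab]//|x /=].
  rewrite in_itv/= => /andP[ax xb].
  have [k kx] := ltr_add_invr ax; have [l lx] := ltr_add_invr xb.
  have le m n : (m <= n)%N -> n.+1%:R^-1 <= m.+1%:R^-1 :> R.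
    by move=> mn; rewrite lef_pV2 ?posrE// ler_nat ltnS.
  exists (maxn k l) => //; rewrite /I /= in_itv/=; apply/andP; split.
    by apply: le_trans (ltW kx); rewrite lerD2l le// leq_maxl.
  rewrite lerBrDr; apply: le_trans (ltW lx).
  by rewrite lerD2l le// leq_maxr.
rewrite -UI.
have mI n : measurable (I n) by exact: measurable_itv.
have ndI : nondecreasing_seq I.
  apply/nondecreasing_seqP => n; rewrite subsetEset => x.
  rewrite /I /= !in_itv/= => /andP[ax xb].
  have le : n.+2%:R^-1 <= n.+1%:R^-1 :> R.
    by rewrite lef_pV2 ?posrE// ler_nat.
  rewrite (le_trans _ ax) ?lerD2l//=.
  by rewrite (le_trans xb)// lerD2l lerN2.
have mf n : measurable_fun (I n) f.
  by apply: measurable_funS (continuous_oo_measurable _ _ _ cf) => // x /Iab.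
have fI0 n x : I n x -> (0 <= (EFin \o f) x)%E.
  by move=> /Iab xI; rewrite lee_fin f0.
have mEf n : measurable_fun (I n) (EFin \o f) by exact/measurable_EFinP.
have cvgI := @ge0_nondecreasing_set_cvg_integral _ _ _ _ _
  (@lebesgue_measure R) ndI mI mEf fI0.
rewrite -(cvg_lim _ cvgI)//; apply: lime_le.
  by apply/cvg_ex; eexists; exact: cvgI.
apply: nearW => n.
(* For small [n] the interval [I n] may be empty or a point; its integral is then 0, and [0 <= M]
   suffices. *)
have [lt|ge] := ltP (a + n.+1%:R^-1) (b - n.+1%:R^-1); last first.
  rewrite /I; move: ge; rewrite le_eqVlt => /predU1P[->|ge].
    by rewrite set_itv1 integral_set1 lee_fin.
  by rewrite set_itv_ge ?integral_set0 ?lee_fin// bnd_simp -ltNge.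
have subI x : x \in `[(a + n.+1%:R^-1), (b - n.+1%:R^-1)] -> x \in `]a, b[.
  exact: Iab.
rewrite /= /I (@continuous_FTC2 _ f F)//.
+ rewrite -EFinB lee_fin FM ?ltrDl ?gtrBl ?invr_gt0//.
+ by apply: continuous_subspace_itv => x /subI; exact: cf.
+ have dI x : x \in `[(a + n.+1%:R^-1), (b - n.+1%:R^-1)] ->
      derivable F x 1.
    by move=> /subI /dF /@ex_derive.
  split.
  * by move=> x /subset_itv_oo_cc; exact: dI.
  * apply: cvg_at_right_filter; apply: differentiable_continuous.
    apply/derivable1_diffP/dI; by rewrite in_itv/= lexx ltW.
  * apply: cvg_at_left_filter; apply: differentiable_continuous.
    apply/derivable1_diffP/dI; by rewrite in_itv/= lexx ltW.
+ move=> x /subset_itv_oo_cc /subI /dF dFx.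
  by rewrite derive1E derive_val.
Qed.

Lemma ge0_integrable_oo F f a b M : 0 <= M ->
  (forall x : R, x \in `]a, b[ -> is_derive x 1 F (f x)) ->
  {in `]a, b[, continuous f} -> {in `]a, b[, forall x, 0 <= f x} ->
  (forall x y, a < x -> x < y -> y < b -> F y - F x <= M) ->
  mu.-integrable `]a, b[ (EFin \o f) /\ \int[mu]_(x in `]a, b[) f x <= M.
Proof.
move=> M0 dF cf f0 FM; have le := ge0_integral_oo_le _ _ _ _ _ M0 dF cf f0 FM.
have fi : mu.-integrable `]a, b[ (EFin \o f).
  apply/integrableP; split.
    by apply/measurable_EFinP; exact: continuous_oo_measurable.
  under eq_integral => x xab.
    rewrite gee0_abs; first over.
    by rewrite lee_fin f0// -inE.
  by apply: le_lt_trans le _; rewrite ltry.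
split => //; rewrite -lee_fin /Rintegral fineK//.
exact: integrable_fin_num.
Qed.

End PrimitiveOnOpenInterval.

(** * Comparison of real-valued integrals *)

Section RintegralComparison.
Context {R : realType}.
Notation mu := (@lebesgue_measure R).

Lemma le_integrableR {D : set R} (f g : R -> R) : measurable D ->
  measurable_fun D f -> (forall x, D x -> `|f x| <= g x) ->
  mu.-integrable D (EFin \o g) -> mu.-integrable D (EFin \o f).
Proof.
move=> mD mf fg; apply: le_integrable => //.
- exact/measurable_EFinP.
- move=> x Dx; rewrite /= lee_fin (le_trans (fg _ Dx))//.
  exact: ler_norm.
Qed.

(** A quantitative form of strict monotonicity: [f] plus [c] times the indicator of [[u, v]] still
    lies below [g]. *)
Lemma le_Rintegral_gap (D : set R) (f g : R -> R) (c u v : R) :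
  measurable D -> u <= v -> `[u, v] `<=` D ->
  mu.-integrable D (EFin \o f) -> mu.-integrable D (EFin \o g) ->
  (forall x, D x -> f x <= g x) -> (forall x, x \in `[u, v] -> f x + c <= g x) ->
  \int[mu]_(x in D) f x + c * (v - u) <= \int[mu]_(x in D) g x.
Proof.
move=> mD uv uvD intf intg fg gap.
have muv : mu `[u, v]%classic = (v - u)%:E.
  rewrite lebesgue_measure_itv/= lte_fin.
  have [//|vu] := ltP u v.
  by have /le_anti -> : (u <= v <= u)%R; rewrite ?subrr// uv vu.
have i1 : mu.-integrable D (EFin \o (\1_`[u, v] : R -> R)).
  exact: integrableS (integrable_indic_itv u v true false).
have ic : mu.-integrable D (EFin \o (fun x => c * \1_`[u, v] x)).
  have := i1; exact: integrableZl.
have -> : c * (v - u) = \int[mu]_(x in D) (c * \1_`[u, v] x).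
  rewrite RintegralZl//; congr (_ * _).
  rewrite /Rintegral integral_indic// (setIidl uvD).
  exact: (congr1 fine (esym muv)).
rewrite -RintegralD//; apply: le_Rintegral => //.
  by have := ic; have := intf; exact: integrableD.
move=> x Dx; rewrite indicE; have [xuv|xuv] := boolP (x \in `[u, v]%classic).
  by rewrite mulr1 gap// -inE.
by rewrite mulr0 addr0 fg.
Qed.

End RintegralComparison.

(** * Scale factors and the Hubble parameter *)

Section ScaleFactorTheory.
Context {R : realType} (a : R -> R) (ra : regular_scale_factor a).
Implicit Types s t x y tau : R.

Lemma scale_factor_lt x y : 0 <= x -> x < y -> a x < a y.
Proof.
move=> x0 xy; case: ra => _ [_ [a_incr _]]; apply: a_incr => //.
- by rewrite in_itv/= andbT.
- by rewrite in_itv/= andbT (le_trans x0) ?ltW.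
Qed.

Lemma scale_factor_le x y : 0 <= x -> x <= y -> a x <= a y.
Proof.
move=> x0; rewrite le_eqVlt => /predU1P[->//|xy].
by rewrite ltW ?scale_factor_lt.
Qed.

Lemma scale_factor_gt0 t : 0 < t -> 0 < a t.
Proof. by case: ra => a0 _; rewrite -{2}a0; exact: scale_factor_lt. Qed.

Lemma is_derive_scale_factor t : 0 < t -> is_derive t 1 a (adot a t).
Proof.
case: ra => _ [_ [_ [_ [_ [da _]]]]] /da[dt _].
by rewrite /adot derive1E; exact: derivableP.
Qed.

Lemma is_derive_adot t : 0 < t -> is_derive t 1 (adot a) (addot a t).
Proof.
case: ra => _ [_ [_ [_ [_ [da _]]]]] /da[_ dt].
by rewrite /addot derive1E; exact: derivableP.
Qed.

Lemma is_derive_continuous (f : R -> R) (x l : R) :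
  is_derive x 1 f l -> {for x, continuous f}.
Proof.
by move=> [df _]; apply: differentiable_continuous; exact/derivable1_diffP.
Qed.

Lemma continuous_scale_factor t : 0 < t -> {for t, continuous a}.
Proof. by move=> /is_derive_scale_factor/is_derive_continuous. Qed.

Lemma continuous_adot t : 0 < t -> {for t, continuous (adot a)}.
Proof. by move=> /is_derive_adot/is_derive_continuous. Qed.

Lemma continuous_addot t : 0 < t -> {for t, continuous (addot a)}.
Proof.
case: ra => _ [_ [_ [_ [_ [_ [ca _]]]]]] t0; apply: ca.
by rewrite in_itv/= t0.
Qed.

(** Monotonicity of [a] alone gives only [0 <= adot a t]; strictness comes from the nonvanishing
    built into regularity. *)
Lemma adot_gt0 t : 0 < t -> 0 < adot a t.
Proof.
move=> t0; case: ra => _ [_ [a_incr [_ [_ [da [_ /(_ t t0)[ad0 _]]]]]]].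
rewrite lt_neqAle eq_sym ad0/=.
apply: (@incr_derive1_ge0_itvy _ a true 0) => //.
- by move=> x; rewrite inE/= in_itv/= andbT => /da[].
- by rewrite in_itv/= t0.
Qed.

Definition hubble t := adot a t / a t.

Lemma hubble_gt0 t : 0 < t -> 0 < hubble t.
Proof. by move=> t0; rewrite divr_gt0 ?adot_gt0 ?scale_factor_gt0. Qed.

Lemma addot_le t : 0 < t -> addot a t * a t <= adot a t ^+ 2.
Proof.
move=> t0; case: ra => _ [_ [_ [_ [_ [_ [_ /(_ t t0)[ad0]]]]]]].
by rewrite /accel_ratio ler_pdivrMr ?exprn_gt0 ?adot_gt0// mul1r mulrC.
Qed.

Lemma is_derive_hubble t : 0 < t ->
  is_derive t 1 hubble ((addot a t * a t - adot a t ^+ 2) / a t ^+ 2).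
Proof.
move=> t0; have a0 : a t != 0 by rewrite gt_eqF ?scale_factor_gt0.
have ad := is_derive_scale_factor _ t0; have dd := is_derive_adot _ t0.
have dV := is_deriveV a0 ad.
apply: (is_derive_eq (is_deriveM dd dV)).
by rewrite /GRing.scale/=; field.
Qed.

Lemma hubble_nincr x y : 0 < x -> x <= y -> hubble y <= hubble x.
Proof.
move=> x0 xy.
have pos t : t \in `[x, y] -> 0 < t.
  by rewrite in_itv/= => /andP[+ _]; exact: lt_le_trans.
apply: (@ler0_derive1_le_cc _ hubble x y) => //.
- by move=> t /subset_itv_oo_cc/pos/is_derive_hubble/@ex_derive.
- move=> t /subset_itv_oo_cc/pos t0.
  have d := is_derive_hubble _ t0; rewrite derive1E derive_val.
  by rewrite pmulr_lle0 ?invr_gt0 ?exprn_gt0 ?scale_factor_gt0// subr_le0 addot_le.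
- by apply: derivable_within_continuous => t /pos/is_derive_hubble/@ex_derive.
- by rewrite in_itv/= lexx andbT.
- by rewrite in_itv/= lexx.
Qed.

(** This supplies positive times at which [a] is as small as desired, in place of a limit argument
    at 0. *)
Lemma scale_factor_surj y : 0 < y -> exists2 t, 0 < t & a t = y.
Proof.
move=> y0; case: ra => a0 [_ [_ [/(_ y (ltW y0))[t t0 aty] _]]].
exists t => //; rewrite lt_neqAle t0 andbT; apply: contraTneq y0 => t00.
by rewrite -aty -t00 a0 ltxx.
Qed.

Lemma scale_factor_ltW x y : 0 <= y -> a x < a y -> x < y.
Proof.
by move=> y0; apply: contraTT; rewrite -!leNgt => /(scale_factor_le _ _ y0).
Qed.

(* Otherwise [a t * expR (- hubble tau * t)] would be nonincreasing, keeping
   [a] away from [0]. *)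
Lemma hubble_exceeds tau : 0 < tau ->
  exists2 t, 0 < t < tau & hubble tau < hubble t.
Proof.
move=> tau0; set k := hubble tau; apply: contrapT => nex.
have le t : 0 < t -> t < tau -> hubble t <= k.
  move=> t0 ttau; rewrite leNgt; apply/negP => kt; apply: nex; exists t => //.
  by rewrite t0.
have y0 : 0 < a tau * expR (- (k * tau)).
  by rewrite mulr_gt0 ?scale_factor_gt0 ?expR_gt0.
(* [a x] is half of [f tau], for the [f] defined below. Since [f x <= a x], this will contradict
   [f tau <= f x]. *)
have [x x0 ax] := scale_factor_surj _ (divr_gt0 y0 (ltr0n _ 2)).
have k0 : 0 < k by exact: hubble_gt0.
have xtau : x < tau.
  apply: scale_factor_ltW; rewrite ?ltW// ax ltr_pdivrMr//.
  rewrite ltr_pM2l ?scale_factor_gt0//.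
  by rewrite (le_lt_trans _ (ltr1n _ 2))// expR_le1 oppr_le0 mulr_ge0 ?ltW.
pose f t := a t * expR (- (k * t)).
have df t : 0 < t -> is_derive t 1 f ((adot a t - k * a t) * expR (- (k * t))).
  move=> t0; have ad := is_derive_scale_factor _ t0.
  have ed : is_derive t 1 (expR \o (fun t => - (k * t)))
      (expR (- (k * t)) * - k).
    apply: is_derive1_comp.
    apply: (is_derive_eq (is_deriveN (is_deriveZ k (is_derive_id t 1)))).
    by rewrite /GRing.scale/= mulr1.
  apply: (is_derive_eq (is_deriveM ad ed)).
  by rewrite /GRing.scale/=; ring.
have pos t : t \in `[x, tau] -> 0 < t.
  by rewrite in_itv/= => /andP[+ _]; exact: lt_le_trans.
have : f tau <= f x.
  apply: (@ler0_derive1_le_cc _ f x tau) => //.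
  - by move=> t /subset_itv_oo_cc/pos/df/@ex_derive.
  - move=> t tx; have t0 := pos _ (subset_itv_oo_cc tx).
    have d := df _ t0; rewrite derive1E derive_val.
    rewrite pmulr_lle0 ?expR_gt0// subr_le0.
    rewrite -ler_pdivrMr ?scale_factor_gt0// le//.
    by move: tx; rewrite in_itv/= => /andP[].
  - by apply: derivable_within_continuous => t /pos/df/@ex_derive.
  - by rewrite in_itv/= lexx andbT ltW.
  - by rewrite in_itv/= lexx ltW.
  - exact: ltW.
apply/negP; rewrite -ltNge /f ax.
apply: le_lt_trans (_ : a tau * expR (- (k * tau)) / 2 < _).
  rewrite ler_piMr ?divr_ge0 ?(ltW y0)//.
  by rewrite expR_le1 oppr_le0 mulr_ge0 ?ltW.
by rewrite ltr_pdivrMr// ltr_pMr// ltr1n.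
Qed.

End ScaleFactorTheory.

(** * The square root in the Fermi integrands *)

Section FermiRoot.
Context {R : realType} (a : R -> R) (ra : regular_scale_factor a).
Context (tau : R) (tau0 : 0 < tau).
Implicit Types s t x y : R.

Definition fermi_root t := Num.sqrt (a tau ^+ 2 - a t ^+ 2).

Let atau0 : 0 < a tau. Proof. exact: scale_factor_gt0. Qed.

Lemma fermi_root_sqr_gt0 t : 0 <= t -> t < tau -> 0 < a tau ^+ 2 - a t ^+ 2.
Proof.
move=> t0 tt; rewrite subr_gt0 ltr_pXn2r// ?nnegrE; last 2 first.
- by case: ra => _ [/(_ t t0)].
- exact: ltW.
exact: scale_factor_lt.
Qed.

Lemma fermi_root_gt0 t : 0 <= t -> t < tau -> 0 < fermi_root t.
Proof. by move=> t0 tt; rewrite sqrtr_gt0 fermi_root_sqr_gt0. Qed.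

Lemma sqr_fermi_root t : 0 <= t -> t < tau ->
  fermi_root t ^+ 2 = a tau ^+ 2 - a t ^+ 2.
Proof. by move=> t0 tt; rewrite sqr_sqrtr// ltW// fermi_root_sqr_gt0. Qed.

Lemma fermi_root_nincr x y : 0 <= x -> x <= y -> fermi_root y <= fermi_root x.
Proof.
move=> x0 xy; have a0 z : 0 <= z -> 0 <= a z by case: ra => _ [+ _]; exact.
have y0 := le_trans x0 xy.
rewrite ler_wsqrtr// lerD2l lerN2 ler_pXn2r ?nnegrE ?a0//.
exact: scale_factor_le.
Qed.

Lemma fermi_root_le t : fermi_root t <= a tau.
Proof.
by rewrite -[leRHS]gtr0_norm// -sqrtr_sqr ler_wsqrtr// gerBl sqr_ge0.
Qed.

(** The product of [a tau - fermi_root t] and [a tau + fermi_root t] is [a t ^+ 2], and the second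
    factor is at least [a tau]. This quadratic smallness later absorbs the factor [K / a t]. *)
Lemma sub_fermi_root_le t : 0 <= t -> t < tau ->
  a tau - fermi_root t <= a t ^+ 2 / a tau.
Proof.
move=> t0 tt; have s0 := fermi_root_gt0 _ t0 tt.
have s2 := sqr_fermi_root _ t0 tt; have sle := fermi_root_le t.
rewrite ler_pdivlMr//; move: atau0; nra.
Qed.

(** In a right triangle with legs [a t] and [fermi_root t], the hypotenuse [a tau] is at most the
    sum of the legs. *)
Lemma sub_scale_factor_le t : 0 < t -> t < tau -> a tau - fermi_root t <= a t.
Proof.
move=> t0 tt; have s0 := fermi_root_gt0 _ (ltW t0) tt.
have s2 := sqr_fermi_root _ (ltW t0) tt; have at0 := scale_factor_gt0 _ ra _ t0.
rewrite leNgt; apply/negP => lt; move: atau0; nra.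
Qed.

Lemma is_derive_fermi_root t : 0 < t -> t < tau ->
  is_derive t 1 fermi_root (- (a t * adot a t / fermi_root t)).
Proof.
move=> t0 tt; have s0 := fermi_root_gt0 _ (ltW t0) tt.
have da := is_derive_scale_factor _ ra _ t0.
have dg : is_derive t 1 (fun y => a tau ^+ 2 - a y ^+ 2) (- (2 * a t * adot a t)).
  apply: (is_derive_eq (is_deriveB (is_derive_cst (a tau ^+ 2) t 1)
    (is_deriveX 2 da))).
  by rewrite /GRing.scale/=; ring.
have ds := is_derive1_sqrt (fermi_root_sqr_gt0 _ (ltW t0) tt).
apply: (is_derive_eq (@is_derive1_comp _ Num.sqrt
  (fun y => a tau ^+ 2 - a y ^+ 2) t _ _ ds dg)).
rewrite -/(fermi_root t); have s_neq0 : fermi_root t != 0 by rewrite gt_eqF.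
by field.
Qed.

Lemma continuous_fermi_root_inv t : 0 < t -> t < tau ->
  {for t, continuous (fun y => (fermi_root y)^-1)}.
Proof.
move=> t0 tt; apply: cvgV; first by rewrite gt_eqF ?fermi_root_gt0 ?ltW.
exact/is_derive_continuous/is_derive_fermi_root.
Qed.

Lemma continuous_addot_ratio t : 0 < t ->
  {for t, continuous (fun y => addot a y / adot a y ^+ 2)}.
Proof.
move=> t0; apply: cvgM; first exact: continuous_addot.
apply: cvgV; first by rewrite expf_neq0// gt_eqF// adot_gt0.
by apply: cvgM; exact: continuous_adot.
Qed.

Lemma continuous_gtt_integrand t0 t : 0 < t -> t < tau ->
  {for t, continuous (gtt_integrand a tau t0)}.
Proof.
move=> tpos tt; apply: cvgM; first exact: continuous_addot_ratio.
apply: cvgB; last exact: cvg_cst.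
by apply: cvgM; [exact: cvg_cst|exact: continuous_fermi_root_inv].
Qed.

Lemma continuous_gtt_limit_integrand t : 0 < t -> t < tau ->
  {for t, continuous (gtt_limit_integrand a tau)}.
Proof.
move=> tpos tt; apply: cvgM; first exact: continuous_addot_ratio.
apply: cvgB; last exact: cvg_cst.
by apply: cvgM; [exact: cvg_cst|exact: continuous_fermi_root_inv].
Qed.

Lemma continuous_fermi_integrand t : 0 < t -> t < tau ->
  {for t, continuous (fermi_integrand a tau)}.
Proof.
move=> tpos tt; apply: cvgM; first exact: continuous_scale_factor.
exact: continuous_fermi_root_inv.
Qed.

End FermiRoot.

(** * Integrability of the Fermi integrand and the behaviour of [t0] near the Fermi radius *)

Section FermiIntegrals.
Context {R : realType} (a : R -> R) (ra : regular_scale_factor a).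
Context (tau : R) (tau0 : 0 < tau).
Implicit Types s t x y : R.
Notation mu := (@lebesgue_measure R).
Notation root := (fermi_root a tau).

Let atau0 : 0 < a tau. Proof. exact: scale_factor_gt0. Qed.

Let itv_pos t : t \in `]0, tau[ -> 0 < t /\ t < tau.
Proof. by rewrite in_itv/= => /andP. Qed.

(* Near [0] the root is bounded below; past [tau / 2] the monotonicity of
   [hubble] bounds [1] by a multiple of [a * adot], and [a * adot / root] is
   the derivative of [- root]. *)
Lemma fermi_root_inv_integrable :
  mu.-integrable `]0, tau[ (EFin \o (fun t => (root t)^-1)).
Proof.
have h0 : 0 < tau / 2 by rewrite divr_gt0.
have htau : tau / 2 < tau by rewrite ltr_pdivrMr// ltr_pMr// ltr1n.
have rh : 0 < root (tau / 2) by rewrite fermi_root_gt0// ltW.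
have ah : 0 < a (tau / 2) by exact: scale_factor_gt0.
have H0 := hubble_gt0 _ ra _ tau0.
(* Past [tau / 2], [a * adot = hubble * a ^ 2] is at least [hubble a tau * a (tau / 2) ^+ 2], so [c]
   makes [c * (a * adot)] at least 1 there. *)
pose c := (hubble a tau * a (tau / 2) ^+ 2)^-1.
have c0 : 0 < c by rewrite invr_gt0 mulr_gt0// exprn_gt0.
pose q t := (root (tau / 2))^-1 + c * (a t * adot a t / root t).
pose Q t := (root (tau / 2))^-1 * t - c * root t.
have qn t : t \in `]0, tau[ -> 0 <= c * (a t * adot a t / root t).
  move=> /itv_pos[t0 tt]; rewrite mulr_ge0 ?divr_ge0 ?mulr_ge0 ?sqrtr_ge0//.
  - exact: ltW.
  - by rewrite ltW// scale_factor_gt0.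
  - by rewrite ltW// adot_gt0.
have dQ t : t \in `]0, tau[ -> is_derive t 1 Q (q t).
  move=> /itv_pos[t0 tt]; have dr := is_derive_fermi_root _ ra _ tau0 _ t0 tt.
  apply: (is_derive_eq (is_deriveB (is_deriveZ (root (tau / 2))^-1
    (is_derive_id t 1)) (is_deriveZ c dr))).
  by rewrite /GRing.scale/= /q; ring.
have cq : {in `]0, tau[, continuous q}.
  move=> t /itv_pos[t0 tt]; apply: cvgD; first exact: cvg_cst.
  apply: cvgM; first exact: cvg_cst.
  apply: cvgM; last exact: continuous_fermi_root_inv.
  by apply: cvgM; [exact: continuous_scale_factor|exact: continuous_adot].
have q0 : {in `]0, tau[, forall t, 0 <= q t}.
  by move=> t /qn tn; rewrite addr_ge0// invr_ge0 ltW.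
have M0 : 0 <= (root (tau / 2))^-1 * tau + c * a tau.
  have u0 : 0 < (root (tau / 2))^-1 by rewrite invr_gt0.
  exact: addr_ge0 (mulr_ge0 (ltW u0) (ltW tau0)) (mulr_ge0 (ltW c0) (ltW atau0)).
have [iq _] : mu.-integrable `]0, tau[ (EFin \o q) /\
    \int[mu]_(x in `]0, tau[) q x <= (root (tau / 2))^-1 * tau + c * a tau.
  apply: (@ge0_integrable_oo _ Q) => // x y x0 xy yt.
  have u0 : 0 < (root (tau / 2))^-1 by rewrite invr_gt0.
  have := mulr_ge0 (ltW c0) (sqrtr_ge0 (a tau ^+ 2 - a y ^+ 2)).
  have : c * root x <= c * a tau by rewrite ler_pM2l ?fermi_root_le.
  have : (root (tau / 2))^-1 * y <= (root (tau / 2))^-1 * tau.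
    by rewrite ler_pM2l ?ltW.
  have := mulr_gt0 u0 x0.
  rewrite /Q -/(root y); lra.
apply: le_integrableR iq => //.
  apply: continuous_oo_measurable => t /itv_pos[t0 tt].
  exact: continuous_fermi_root_inv.
move=> t td; have [t0 tt] := itv_pos _ td.
rewrite ger0_norm ?invr_ge0 ?sqrtr_ge0// /q.
have rt : 0 < root t by rewrite fermi_root_gt0// ltW.
have [th|ht] := leP t (tau / 2).
  rewrite ler_wpDr ?qn// lef_pV2 ?posrE//.
  by rewrite fermi_root_nincr// ltW.
rewrite ler_wpDl ?invr_ge0 ?(ltW rh)// mulrA ler_pMl ?invr_gt0//.
have c1 : c * (hubble a tau * a (tau / 2) ^+ 2) = 1.
  by rewrite mulVf// gt_eqF// mulr_gt0// exprn_gt0.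
rewrite -c1 ler_pM2l//.
have at0 := scale_factor_gt0 _ ra _ t0.
have -> : a t * adot a t = hubble a t * a t ^+ 2.
  by rewrite /hubble; have : a t != 0 by [rewrite gt_eqF]; move=> ?; field.
rewrite ler_pM ?(ltW H0) ?sqr_ge0 ?hubble_nincr ?(ltW tt)//.
by rewrite ler_pXn2r ?nnegrE ?(ltW ah) ?(ltW at0)// scale_factor_le ?ltW.
Qed.

Lemma fermi_integrand_ge0 t : 0 <= t -> 0 <= fermi_integrand a tau t.
Proof.
by move=> t0; rewrite divr_ge0 ?sqrtr_ge0//; case: ra => _ [/(_ t t0)].
Qed.

Lemma fermi_integrand_integrable :
  mu.-integrable `]0, tau[ (EFin \o fermi_integrand a tau).
Proof.
have iJ : mu.-integrable `]0, tau[ (EFin \o (fun t => a tau * (root t)^-1)).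
  by have := fermi_root_inv_integrable; exact: integrableZl.
apply: le_integrableR iJ => //.
  apply: continuous_oo_measurable => t /itv_pos[t0 tt].
  exact: continuous_fermi_integrand.
move=> t /itv_pos[t0 tt]; rewrite ger0_norm ?fermi_integrand_ge0 ?(ltW t0)//.
apply: ler_wpM2r; first by rewrite invr_ge0 sqrtr_ge0.
by rewrite scale_factor_le// ltW.
Qed.

(** Extension by 0 puts integrals with different lower end points on one domain, where they can be
    compared pointwise. *)
Lemma Rintegral_suffix (f : R -> R) x : 0 <= x ->
  \int[mu]_(t in `]x, tau[) f t =
  \int[mu]_(t in `]0, tau[) (f \_ `]x, tau[) t.
Proof.
move=> x0; rewrite -Rintegral_mkcondr setIidr// => t/=.
by rewrite !in_itv/= => /andP[xt ->]; rewrite (le_lt_trans x0 xt).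
Qed.

Lemma integrable_suffix (f : R -> R) x : 0 <= x ->
  mu.-integrable `]0, tau[ (EFin \o f) ->
  mu.-integrable `]0, tau[ (EFin \o (f \_ `]x, tau[)).
Proof.
move=> x0 intf; have /integrableP[/measurable_EFinP mf _] := intf.
have inf : mu.-integrable `]0, tau[ (EFin \o (fun t => `|f t|)).
  by have := intf; exact: integrable_norm.
apply: le_integrableR inf => //.
  by apply/measurable_restrict => //; apply: measurable_funS mf.
by move=> t _; rewrite patchE; case: ifP => _ //; rewrite normr0.
Qed.

(** On [[e / 2, e]] the integrand truncated at [x] vanishes, while the full one is at least
    [a (e / 2) / a tau]. The gap does not depend on [x]. *)
Lemma rho_of_t0_gap e x : 0 < e -> e <= x -> x < tau ->
  rho_of_t0 a tau x + a (e / 2) / a tau * (e / 2) <= fermi_radius a tau.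
Proof.
move=> e0 ex xtau; have etau := le_lt_trans ex xtau.
have e2 : 0 < e / 2 by rewrite divr_gt0.
have e2e : e / 2 < e by rewrite ltr_pdivrMr// ltr_pMr// ltr1n.
have x0 : 0 <= x by rewrite (le_trans _ ex)// ltW.
rewrite /fermi_radius /rho_of_t0 Rintegral_suffix//.
have {2}-> : e / 2 = e - e / 2 by rewrite {2}(splitr e) addrK.
have ifi := fermi_integrand_integrable.
apply: le_Rintegral_gap => //.
- exact: ltW.
- move=> t /=; rewrite !in_itv/= => /andP[et te].
  by rewrite (lt_le_trans e2 et)/= (le_lt_trans te).
- exact: integrable_suffix.
- move=> t /itv_pos[t0 tt]; rewrite patchE; case: ifP => // _.
  by rewrite fermi_integrand_ge0// ltW.
- move=> t; rewrite in_itv/= => /andP[et te].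
  have t0 := lt_le_trans e2 et; have tt := le_lt_trans te etau.
  rewrite patchE ifF; last first.
    by apply/negbTE; rewrite notin_setE/= in_itv/= ltNge (le_trans te ex).
  rewrite add0r /fermi_integrand ler_pM ?invr_ge0 ?(ltW atau0)//.
  + by rewrite ltW// scale_factor_gt0.
  + by rewrite scale_factor_le// ltW.
  + by rewrite lef_pV2 ?posrE ?fermi_root_le// fermi_root_gt0// ltW.
Qed.

(** Positivity ensures that [rho] close to the radius from the left is positive, as the equation
    defining [t0] demands. *)
Lemma fermi_radius_gt0 : 0 < fermi_radius a tau.
Proof.
have h0 : 0 < tau / 2 by rewrite divr_gt0.
have htau : tau / 2 < tau by rewrite ltr_pdivrMr// ltr_pMr// ltr1n.
apply: lt_le_trans (rho_of_t0_gap _ _ h0 (lexx _) htau).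
rewrite ltr_wpDl//; last first.
  by rewrite !mulr_gt0 ?invr_gt0// scale_factor_gt0// divr_gt0.
apply: Rintegral_ge0 => t /=; rewrite in_itv/= => /andP[ht _].
by rewrite fermi_integrand_ge0// ltW// (lt_trans h0).
Qed.

(* [fermi_radius - rho_of_t0 x] is bounded below on [e, tau[ for every
   [e > 0], so [rho] close to the radius forces [t0_of rho] below [e]. *)
Lemma scale_factor_t0_cvg (t0_of : R -> R) :
  (forall rho, 0 < rho < fermi_radius a tau ->
     0 < t0_of rho < tau /\ rho_of_t0 a tau (t0_of rho) = rho) ->
  a (t0_of rho) @[rho --> (fermi_radius a tau)^'-] --> (0 : R).
Proof.
move=> t0P; apply/cvgrPdist_le => eps eps0.
(* The bound [a tau / 2] forces [e < tau] for the point [e] where [a] takes this value. *)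
have y0 : 0 < Num.min eps (a tau / 2) by rewrite lt_min eps0 divr_gt0.
have [e e0 ae] := scale_factor_surj _ ra _ y0.
have etau : e < tau.
  apply: (scale_factor_ltW _ ra); rewrite ?(ltW tau0)// ae gt_min.
  by rewrite ltr_pdivrMr// ltr_pMr// ltr1n orbT.
have d0 : 0 < a (e / 2) / a tau * (e / 2).
  by rewrite !mulr_gt0 ?invr_gt0// scale_factor_gt0// divr_gt0.
near=> rho.
have rM : rho < fermi_radius a tau by near: rho; exact: nbhs_left_lt.
have r0 : 0 < rho by near: rho; apply: nbhs_left_gt; exact: fermi_radius_gt0.
have rd : fermi_radius a tau - a (e / 2) / a tau * (e / 2) < rho.
  by near: rho; apply: nbhs_left_gt; rewrite gtrBl.
have [/andP[x0 xt] rhoE] := t0P rho (introT andP (conj r0 rM)).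
rewrite sub0r normrN gtr0_norm ?(scale_factor_gt0 _ ra)//.
have xe : t0_of rho < e.
  rewrite ltNge; apply/negP => ex; have := rho_of_t0_gap _ _ e0 ex xt.
  by rewrite rhoE leNgt -ltrBlDr rd.
rewrite (le_trans (scale_factor_le _ ra _ _ (ltW x0) (ltW xe)))//.
by rewrite ae ge_min lexx.
Unshelve. all: by end_near. Qed.

End FermiIntegrals.

(** * The integrals in [g_tautau]: convergence and the bound 1 *)

Section GttIntegrals.
Context {R : realType} (a : R -> R) (ra : regular_scale_factor a).
Context (tau : R) (tau0 : 0 < tau) (K : R) (K1 : 1 <= K).
Context (Ka : forall t, 0 < t -> - K <= accel_ratio a t).
Implicit Types s t x y : R.
Notation mu := (@lebesgue_measure R).
Notation root := (fermi_root a tau).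

Let atau0 : 0 < a tau. Proof. exact: scale_factor_gt0. Qed.

Let itv_pos t : t \in `]0, tau[ -> 0 < t /\ t < tau.
Proof. by rewrite in_itv/= => /andP. Qed.

Let K0 : 0 <= K. Proof. exact: le_trans K1. Qed.

(** The ratio [accel_ratio a t] lies between [- K] and 1, and [1 <= K] makes the bound symmetric. *)
Lemma addot_ratio_norm_le t : 0 < t -> `|addot a t / adot a t ^+ 2| <= K / a t.
Proof.
move=> t0; have at0 := scale_factor_gt0 _ ra _ t0.
have -> : addot a t / adot a t ^+ 2 = accel_ratio a t / a t.
  have : a t != 0 by rewrite gt_eqF.
  have : adot a t != 0 by rewrite gt_eqF// adot_gt0.
  by move=> ? ?; rewrite /accel_ratio; field; apply/andP.
rewrite normrM normfV (gtr0_norm at0) ler_pM2r ?invr_gt0//.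
rewrite ler_norml Ka//=; apply: le_trans K1.
by case: ra => _ [_ [_ [_ [_ [_ [_ /(_ t t0)[]]]]]]].
Qed.

(** In [a tau / root t - 1 = (a tau - root t) / root t] the numerator is at most [a t ^+ 2 / a tau],
    which cancels the singularity of [K / a t] at 0. *)
Lemma gtt_limit_integrand_norm_le t : 0 < t -> t < tau ->
  `|gtt_limit_integrand a tau t| <= K * (a t / a tau) / root t.
Proof.
move=> t0 tt; have at0 := scale_factor_gt0 _ ra _ t0.
have rt := fermi_root_gt0 _ ra _ tau0 _ (ltW t0) tt.
rewrite /gtt_limit_integrand normrM -/(root t).
have -> : a tau / root t - 1 = (a tau - root t) / root t.
  by have : root t != 0 by [rewrite gt_eqF]; move=> ?; field.
rewrite (normrM (a tau - root t)) normfV (gtr0_norm rt) [leLHS]mulrA.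
rewrite ler_pM2r ?invr_gt0//.
rewrite (@ger0_norm _ (a tau - root t)) ?subr_ge0 ?fermi_root_le//.
apply: (@le_trans _ _ (K / a t * (a t ^+ 2 / a tau))).
  rewrite ler_pM// ?subr_ge0 ?fermi_root_le ?addot_ratio_norm_le//.
  by rewrite sub_fermi_root_le// ltW.
rewrite le_eqVlt; apply/orP; left; apply/eqP.
have : a t != 0 by rewrite gt_eqF.
have : a tau != 0 by rewrite gt_eqF.
by move=> ? ?; field; apply/andP.
Qed.

(** The terms [- 1] cancel, leaving the numerator [root x - a tau], quadratic in [a x]; as [x < t],
    [K / a t] is at most [K / a x]. *)
Lemma gtt_integrand_sub_norm_le x t : 0 < x -> x < t -> t < tau ->
  `|gtt_integrand a tau x t - gtt_limit_integrand a tau t| <=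
  K * (a x / a tau) / root t.
Proof.
move=> x0 xt tt; have t0 := lt_trans x0 xt; have xtau := lt_trans xt tt.
have ax0 := scale_factor_gt0 _ ra _ x0; have at0 := scale_factor_gt0 _ ra _ t0.
have axt := scale_factor_lt _ ra _ _ (ltW x0) xt.
have rt := fermi_root_gt0 _ ra _ tau0 _ (ltW t0) tt.
rewrite /gtt_integrand /gtt_limit_integrand -/(root t) -/(root x).
rewrite -mulrBr opprB addrA subrK -mulrBl normrM.
rewrite (normrM (root x - a tau)) normfV (gtr0_norm rt) [leLHS]mulrA.
rewrite ler_pM2r ?invr_gt0//.
rewrite distrC (@ger0_norm _ (a tau - root x)) ?subr_ge0 ?fermi_root_le//.
apply: (@le_trans _ _ (K / a x * (a x ^+ 2 / a tau))).
  rewrite ler_pM// ?subr_ge0 ?fermi_root_le//.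
  - rewrite (le_trans (addot_ratio_norm_le _ t0))// ler_wpM2l//.
    by rewrite lef_pV2 ?posrE// ltW.
  - by rewrite sub_fermi_root_le// ltW.
rewrite le_eqVlt; apply/orP; left; apply/eqP.
have : a x != 0 by rewrite gt_eqF.
have : a tau != 0 by rewrite gt_eqF.
by move=> ? ?; field; apply/andP.
Qed.

Lemma gtt_limit_integrand_integrable :
  mu.-integrable `]0, tau[ (EFin \o gtt_limit_integrand a tau).
Proof.
have iJ : mu.-integrable `]0, tau[ (EFin \o (fun t => K * (root t)^-1)).
  by have := fermi_root_inv_integrable _ ra _ tau0; exact: integrableZl.
apply: le_integrableR iJ => //.
  apply: continuous_oo_measurable => t /itv_pos[t0 tt].
  exact: continuous_gtt_limit_integrand.
move=> t /itv_pos[t0 tt]; apply: le_trans (gtt_limit_integrand_norm_le _ t0 tt) _.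
apply: ler_wpM2r; first by rewrite invr_ge0 sqrtr_ge0.
by rewrite ler_piMr// ler_pdivrMr// mul1r scale_factor_le// ltW.
Qed.

(* Below [x] the truncated integrand vanishes and [a t <= a x]; hence both
   regimes of [t] obey the same bound, which is linear in [a x]. *)
Lemma gtt_Rintegral_sub_norm_le x : 0 < x -> x < tau ->
  `|\int[mu]_(t in `]x, tau[) gtt_integrand a tau x t -
    \int[mu]_(t in `]0, tau[) gtt_limit_integrand a tau t| <=
  a x * (K / a tau * \int[mu]_(t in `]0, tau[) (root t)^-1).
Proof.
move=> x0 xtau; set g := gtt_integrand a tau x; set G := gtt_limit_integrand a tau.
have ax0 := scale_factor_gt0 _ ra _ x0.
have iJ := fermi_root_inv_integrable _ ra _ tau0.
have iG := gtt_limit_integrand_integrable.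
pose d t := (g \_ `]x, tau[) t - G t.
pose B t := a x * (K / a tau) * (root t)^-1.
have iB : mu.-integrable `]0, tau[ (EFin \o B).
  by have := iJ; exact: integrableZl.
have mg : measurable_fun `]0, tau[ (g \_ `]x, tau[).
  apply/measurable_restrict => //.
  apply: (@measurable_funS _ _ _ _ `]0, tau[%classic) => //.
  apply: continuous_oo_measurable => t /itv_pos[t0 tt].
  exact: continuous_gtt_integrand.
have mG : measurable_fun `]0, tau[ G.
  by have /integrableP[/measurable_EFinP] := iG.
have dB t : `]0, tau[%classic t -> `|d t| <= B t.
  move=> /itv_pos[t0 tt].
  have -> : B t = K * (a x / a tau) / root t by rewrite /B; ring.
  rewrite /d patchE.
  case: ifPn => [|].
    rewrite inE/= in_itv/= => /andP[xt _].
    exact: gtt_integrand_sub_norm_le.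
  rewrite notin_setE/= in_itv/= tt andbT => /negP; rewrite -leNgt => tx.
  rewrite sub0r normrN (le_trans (gtt_limit_integrand_norm_le _ t0 tt))//.
  apply: ler_wpM2r; first by rewrite invr_ge0 sqrtr_ge0.
  by rewrite ler_wpM2l// ler_pM2r ?invr_gt0// scale_factor_le// ltW.
have id : mu.-integrable `]0, tau[ (EFin \o d).
  by apply: le_integrableR dB iB => //; exact: measurable_funB.
(* The truncated integrand is integrable as the sum of the dominated difference [d] and the limit
   [G]. *)
have ig : mu.-integrable `]0, tau[ (EFin \o (g \_ `]x, tau[)).
  have -> : EFin \o (g \_ `]x, tau[) = EFin \o (fun t => d t + G t).
    by apply/funext => t; rewrite /d /= subrK.
  by have := iG; have := id; exact: integrableD.
rewrite Rintegral_suffix ?(ltW x0)// -RintegralB// mulrA -RintegralZl//.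
apply: le_trans (le_normr_Rintegral _ _) _ => //.
apply: le_Rintegral => //.
by have := id; exact: integrable_norm.
Qed.

(* With [u = a t / a tau] this is [1 - sqrt (1 - u ^ 2)] over [u], whose
   [u]-derivative is [(1 / sqrt (1 - u ^ 2) - 1) / u ^ 2]. *)
Definition exponential_primitive t := (a tau - root t) / a t.

(** When [hubble] is constant, this is exactly [adot a tau * gtt_limit_integrand a tau t]. *)
Definition exponential_density t :=
  a tau * adot a t / a t ^+ 2 * (a tau / root t - 1).

Lemma is_derive_exponential_primitive t : 0 < t -> t < tau ->
  is_derive t 1 exponential_primitive (exponential_density t).
Proof.
move=> t0 tt; have at0 : a t != 0 by rewrite gt_eqF// scale_factor_gt0.
have rt : root t != 0 by rewrite gt_eqF// fermi_root_gt0// ltW.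
have da := is_derive_scale_factor _ ra _ t0.
have dr := is_derive_fermi_root _ ra _ tau0 _ t0 tt.
apply: (is_derive_eq (is_deriveM (is_deriveB (is_derive_cst (a tau) t 1) dr)
  (is_deriveV at0 da))).
rewrite /GRing.scale/= /exponential_density fctE/= -[(- root) t]/(- root t) /cst.
have r2 := sqr_fermi_root _ ra _ tau0 _ (ltW t0) tt.
have a2 : a t ^+ 2 = a tau ^+ 2 - root t ^+ 2 by rewrite r2 opprB addrC subrK.
(* The quotient rule yields this form. Replacing [a t ^+ 2] in the numerator only turns the bracket
   into [a tau * (a tau - root t)]. *)
transitivity (adot a t * (a t ^+ 2 - a tau * root t + root t ^+ 2) /
  (root t * a t ^+ 2)); first by field; apply/andP.
by rewrite [in X in _ * (X - _ + _)]a2; field; apply/andP.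
Qed.

(** The value at [y] is at most 1 by [sub_scale_factor_le], and the value at [x] is nonnegative. *)
Lemma exponential_primitive_le1 x y : 0 < x -> x < y -> y < tau ->
  exponential_primitive y - exponential_primitive x <= 1.
Proof.
move=> x0 xy yt; have y0 := lt_trans x0 xy.
rewrite lerBlDr ler_wpDr//.
  by rewrite divr_ge0 ?subr_ge0 ?fermi_root_le// ltW// scale_factor_gt0.
by rewrite ler_pdivrMr ?scale_factor_gt0// mul1r sub_scale_factor_le.
Qed.

Let phi_ge0 t : 0 < t -> t < tau -> 0 <= a tau / root t - 1.
Proof.
move=> t0 tt; rewrite subr_ge0 ler_pdivlMr ?mul1r ?fermi_root_le//.
by rewrite fermi_root_gt0// ltW.
Qed.

(** The right side equals [adot a tau / a t * (a tau / root t - 1)], so [addot_le] suffices. The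
    subtracted term records the excess of [hubble a t] over [hubble a tau], the source of
    strictness. *)
Lemma gtt_limit_integrand_le t : 0 < t -> t < tau ->
  adot a tau * gtt_limit_integrand a tau t <=
  exponential_density t -
    a tau / a t * (hubble a t - hubble a tau) * (a tau / root t - 1).
Proof.
move=> t0 tt; have at0 := scale_factor_gt0 _ ra _ t0.
have at0' : a t != 0 by rewrite gt_eqF.
have atau0' : a tau != 0 by rewrite gt_eqF.
have ad0 := adot_gt0 _ ra _ t0; have ad0' : adot a t != 0 by rewrite gt_eqF.
rewrite /exponential_density /gtt_limit_integrand -/(root t) mulrA -mulrBl.
apply: ler_wpM2r; first exact: phi_ge0.
have -> : a tau * adot a t / a t ^+ 2 -
    a tau / a t * (hubble a t - hubble a tau) = adot a tau / a t.
  by rewrite /hubble; field; apply/andP.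
apply: ler_wpM2l; first by rewrite ltW// adot_gt0.
rewrite ler_pdivrMr ?exprn_gt0// mulrC ler_pdivlMr// addot_le//.
Qed.

(* For exponential growth the bound [1] is attained, but [a 0 = 0] forces
   [hubble] to exceed [hubble tau] near [0]. *)
Lemma adot_gtt_limit_Rintegral_lt1 :
  adot a tau * \int[mu]_(t in `]0, tau[) gtt_limit_integrand a tau t < 1.
Proof.
have [p0 pint] : mu.-integrable `]0, tau[ (EFin \o exponential_density) /\
    \int[mu]_(t in `]0, tau[) exponential_density t <= 1.
  apply: (@ge0_integrable_oo _ exponential_primitive) => //.
  - by move=> t /itv_pos[t0 tt]; exact: is_derive_exponential_primitive.
  - move=> t /itv_pos[t0 tt]; apply: cvgM.
      apply: cvgM; first by apply: cvgM; [exact: cvg_cst|exact: continuous_adot].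
      apply: cvgV; first by rewrite expf_neq0// gt_eqF// scale_factor_gt0.
      by apply: cvgM; exact: continuous_scale_factor.
    apply: cvgB; last exact: cvg_cst.
    by apply: cvgM; [exact: cvg_cst|exact: continuous_fermi_root_inv].
  - move=> t /itv_pos[t0 tt]; rewrite mulr_ge0 ?phi_ge0//.
    rewrite divr_ge0 ?sqr_ge0// mulr_ge0 ?(ltW atau0)//.
    by rewrite ltW// adot_gt0.
  - exact: exponential_primitive_le1.
have [t1 /andP[t10 t1t] ht1] := hubble_exceeds _ ra _ tau0.
have h0 : 0 < t1 / 2 by rewrite divr_gt0.
have ht : t1 / 2 < t1 by rewrite ltr_pdivrMr// ltr_pMr// ltr1n.
have htau := lt_trans ht t1t.
have rh0 : 0 < root (t1 / 2) by rewrite fermi_root_gt0// ltW.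
have phi0 : 0 < a tau / root (t1 / 2) - 1.
  rewrite subr_gt0 ltr_pdivlMr// mul1r.
  have r2 := sqr_fermi_root _ ra _ tau0 _ (ltW h0) htau.
  have := scale_factor_gt0 _ ra _ h0; have := fermi_root_le _ ra _ tau0 (t1 / 2).
  rewrite le_eqVlt => /predU1P[E|//] a0; move: r2; rewrite E.
  by move=> /eqP; rewrite eq_sym subr_eq addrC -subr_eq subrr eq_sym sqrf_eq0 gt_eqF.
(* A lower bound for the subtracted term on [[t1 / 2, t1]]: there [a tau / a t] is at least 1,
   [hubble a t] is least at [t1], and [a tau / root t] is least at [t1 / 2]. *)
pose c := (hubble a t1 - hubble a tau) * (a tau / root (t1 / 2) - 1).
have c0 : 0 < c by rewrite mulr_gt0// subr_gt0.
have iG := gtt_limit_integrand_integrable.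
have iaG : mu.-integrable `]0, tau[
    (EFin \o (fun t => adot a tau * gtt_limit_integrand a tau t)).
  by have := iG; exact: integrableZl.
rewrite -RintegralZl//; apply: lt_le_trans pint.
have gap : \int[mu]_(t in `]0, tau[) (adot a tau * gtt_limit_integrand a tau t)
    + c * (t1 - t1 / 2) <= \int[mu]_(t in `]0, tau[) exponential_density t.
  apply: le_Rintegral_gap => //.
  - exact: ltW.
  - move=> t /=; rewrite !in_itv/= => /andP[lt gt].
    by rewrite (lt_le_trans h0 lt) (le_lt_trans gt t1t).
  - move=> t /itv_pos[t0 tt].
    rewrite (le_trans (gtt_limit_integrand_le _ t0 tt))// gerBl.
    rewrite mulr_ge0 ?phi_ge0// mulr_ge0// ?subr_ge0 ?hubble_nincr ?(ltW tt)//.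
    by rewrite divr_ge0 ?(ltW atau0)// ltW// scale_factor_gt0.
  - move=> t; rewrite in_itv/= => /andP[lt gt].
    have t0 := lt_le_trans h0 lt; have tt := le_lt_trans gt t1t.
    have at0 := scale_factor_gt0 _ ra _ t0.
    have rt0 := fermi_root_gt0 _ ra _ tau0 _ (ltW t0) tt.
    have cle : c <= a tau / a t * (hubble a t - hubble a tau) *
        (a tau / root t - 1).
      apply: ler_pM; rewrite ?(ltW phi0) ?subr_ge0 ?(ltW ht1)//.
      + rewrite -[leLHS]mul1r; apply: ler_pM; rewrite ?subr_ge0 ?(ltW ht1)//.
        * by rewrite ler_pdivlMr// mul1r scale_factor_le// ltW.
        * by rewrite lerD2r hubble_nincr.
      + rewrite lerD2r; apply: ler_wpM2l; first exact: ltW.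
        by rewrite lef_pV2 ?posrE// fermi_root_nincr// ltW.
    by rewrite -lerBrDr (le_trans (gtt_limit_integrand_le _ t0 tt))// lerB.
apply: lt_le_trans gap; rewrite ltrDl mulr_gt0// subr_gt0//.
Qed.

End GttIntegrals.

(** * Limit and positivity at the Fermi radius *)

Theorem theorem4p2 (R : realType) (a : R -> R) (tau : R)
  (t0_of : R -> R) :
  strongly_regular_scale_factor a -> 0 < tau ->
  (* t0 = t0(tau, rho) in (0, tau) is defined by rho = int_{t0}^{tau} ... *)
  (forall rho, 0 < rho < fermi_radius a tau ->
     0 < t0_of rho < tau /\ rho_of_t0 a tau (t0_of rho) = rho) ->
  [/\ (fun rho => g_tautau a tau (t0_of rho)) @ (fermi_radius a tau)^'-
        --> g_tautau_limit a tau,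
      (* -g_{tau tau}(tau, rho_M) < oo : the limiting integral converges *)
      (@lebesgue_measure R).-integrable `]0, tau[
        (fun t => (gtt_limit_integrand a tau t)%:E)
    & 0 < - g_tautau_limit a tau].
Proof.
move=> [ra [K K1 Ka]] tau0 t0P; split; last 2 first.
- exact: gtt_limit_integrand_integrable K1 Ka.
- rewrite opprK exprn_gt0//.
  by rewrite subr_gt0 (adot_gtt_limit_Rintegral_lt1 _ ra _ tau0 _ K1 Ka).
(* [C] is the factor of [a x] in [gtt_Rintegral_sub_norm_le]; being independent of [rho], it leaves
   an error [a (t0_of rho) * C] that tends to 0. *)
set C := K / a tau * \int[lebesgue_measure]_(t in `]0, tau[)
  (fermi_root a tau t)^-1.
have aC : a (t0_of rho) * C @[rho --> (fermi_radius a tau)^'-] --> (0 : R).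
  rewrite -(mul0r C); apply: cvgM; last exact: cvg_cst.
  exact: scale_factor_t0_cvg.
have cvgI : (\int[lebesgue_measure]_(t in `]t0_of rho, tau[)
      gtt_integrand a tau (t0_of rho) t) @[rho --> (fermi_radius a tau)^'-] -->
    \int[lebesgue_measure]_(t in `]0, tau[) gtt_limit_integrand a tau t.
  apply/cvgrPdist_le => eps eps0.
  move/cvgrPdist_le : aC => /(_ _ eps0) aC.
  near=> rho.
  have rM : rho < fermi_radius a tau by near: rho; exact: nbhs_left_lt.
  have r0 : 0 < rho.
    by near: rho; apply: nbhs_left_gt; exact: (fermi_radius_gt0 _ ra _ tau0).
  have [/andP[x0 xt] _] := t0P rho (introT andP (conj r0 rM)).
  rewrite distrC.
  apply: le_trans (gtt_Rintegral_sub_norm_le _ ra _ tau0 _ K1 Ka _ x0 xt) _.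
  (* The bound is put in the shape of a distance to 0, as [aC] provides it. *)
  rewrite -/C (le_trans (ler_norm _))// -normrN -sub0r.
  by near: rho.
apply: cvgN; rewrite expr2.
under eq_fun do rewrite expr2.
by apply: cvgM; apply: cvgB; [exact: cvg_cst| |exact: cvg_cst|];
  apply: cvgM => //; exact: cvg_cst.
Unshelve. all: by end_near. Qed.
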